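(* Let $\{X_n\}_{n=1}^\infty$ be nonnegative, bounded, i.i.d. random variables with $\mathbb E(\ln X_1)=0$ and $\mathbb E\big((\ln X_1)^2\big)\in(0,\infty)$, and let $$f(z)=\sum_{n=1}^\infty\frac1{n^{n^\alpha}}z^n,\qquad\alpha>0.$$ Then $f\in H_*$ if and only if $\alpha\ge\frac12$.
   Context: For the i.i.d. sequence $\{X_n\}$ on a probability space $(\Omega,\mathcal F,\mathbb P)$ put $w_0=1$, $w_n=X_1\cdots X_n$ ($n\ge1$). For each $\omega$, the random Hardy space is $H^2_\mu(\omega)=\{f(z)=\sum_{n\ge0}a_nz^n:\ \sum_{n\ge0}|a_n|^2w_n(\omega)^2<\infty\}$, where $\mu$ is the law of $X_1$. $H_*$ is the set of $f(z)=\sum_{n\ge0}a_nz^n$ such that $f\in H^2_\mu$ almost surely. *)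

(* Defs.v *)
From HB Require Import structures.
From mathcomp Require Import all_boot all_order all_algebra finmap.
From mathcomp Require Import complex.
From mathcomp Require Import all_classical all_reals all_analysis.

Set Implicit Arguments.
Unset Strict Implicit.
Unset Printing Implicit Defensive.

Import Order.TTheory GRing.Theory Num.Theory.
Import numFieldNormedType.Exports.

Local Open Scope classical_set_scope.
Local Open Scope ring_scope.

Section iid.
Context {d : measure_display} {T : measurableType d} {R : realType}.
Variable P : probability T R.

Definition mutually_independent (X : nat -> {RV P >-> R}) : Prop :=
  forall (J : {fset nat}) (A : nat -> set R),
    (forall i, measurable (A i)) ->
    (P (\bigcap_(i in [set` J]) (X i @^-1` A i))
     = \prod_(i <- J) P (X i @^-1` A i))%E.

Definition identically_distributed (X : nat -> {RV P >-> R}) : Prop :=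
  forall n (A : set R), measurable A ->
    distribution P (X n) A = distribution P (X 0%N) A.

Definition iid (X : nat -> {RV P >-> R}) : Prop :=
  mutually_independent X /\ identically_distributed X.

End iid.

Section random_hardy.
Context {d : measure_display} {T : measurableType d} {R : realType}.
Variable P : probability T R.

(* The sequence X_1, X_2, ... is indexed from 0: [X i] stands for X_(i+1). *)
Definition weight (X : nat -> {RV P >-> R}) (n : nat) (w : T) : R :=
  \prod_(i < n) X i w.

(* A power series sum_n a_n z^n is represented by its coefficients. *)
Definition hardy_space (X : nat -> {RV P >-> R}) (w : T) : set (nat -> R[i]) :=
  [set a | (\sum_(0 <= n <oo)
              (ComplexField.Normc.normc (a n) ^+ 2 * weight X n w ^+ 2)%:E
            < +oo)%E].

Definition hardy_star (X : nat -> {RV P >-> R}) : set (nat -> R[i]) :=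
  [set a | {ae P, forall w, hardy_space X w a}].

End random_hardy.

(* The coefficient at n = 0 is set apart because 0 `^ (0 `^ alpha) = 1. *)
Definition fcoef {R : realType} (alpha : R) (n : nat) : R[i] :=
  if n == 0%N then 0 else ((n%:R `^ (n%:R `^ alpha))^-1)%:C%C.

(* Main.v *)
Require Import Defs.
From mathcomp Require Import all_boot all_order all_algebra finmap.
From mathcomp Require Import complex.
From mathcomp Require Import all_classical all_reals all_analysis.
From mathcomp Require Import measurable_realfun ring lra.
Set Implicit Arguments.
Unset Strict Implicit.
Unset Printing Implicit Defensive.
Import Order.TTheory GRing.Theory Num.Theory.
Import numFieldNormedType.Exports.
Local Open Scope classical_set_scope.
Local Open Scope ring_scope.

(** Write w_n = X_1 ... X_n.  Everything is read off from the fractional moments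
    E[w_n^l] with l of order 1 / sqrt n, the scale of the central limit theorem
    for S_n = ln w_n.  As ln X_1 is centred, has finite nonzero variance and is
    bounded above, the moment generating function of ln X_1 is squeezed, for
    small l >= 0, between 1 + c l^2 and 1 + C l^2 with c > 0 ([mgf_ge_quad],
    [mgf_le_quad]).  Independence and identical distribution turn this into
    E[w_n^l] = (E[X_1^l])^n ([integral_weight_powR]), hence
    E[w_n^(K / sqrt n)] <= B for all n ([integral_weight_powR_sqrt_le]), while
    E[w_n^(1 / sqrt n)] >= 1 + c ([integral_weight_powR_sqrt_ge]).

    If alpha >= 1/2, the upper bound with K = 6 shows that the series of
    w_n^(6 / sqrt n) / ((n + 1) (n + 2)) has finite expectation, so it converges
    almost surely; its terms are eventually at most 1, which says
    w_n^2 <= n^(sqrt n).  The squared coefficient n^(- 2 n^alpha) is at most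
    n^(- 2 sqrt n), so the series defining the Hardy norm is eventually dominated
    by n^(- sqrt n) <= n^(-3) ([hardy_star_of_moment_bound]).

    If alpha < 1/2 and the Hardy norm is almost surely finite, its terms are
    eventually at most 1, that is w_n <= n^(n^alpha), and so W_n = w_n^(1 / sqrt n)
    is at most exp(n^(alpha - 1/2) ln n), which tends to 1.  The upper bound
    with K = 2 controls E[W_n^2], so truncating W_n at a high level changes its
    mean by little, and limsup E[W_n] <= 1; this contradicts E[W_n] >= 1 + c
    ([not_hardy_star_of_moment_bounds]). *)

(** * Quadratic bounds for the exponential *)

Section exp_bounds.
Context {R : realType}.
Implicit Types u l y : R.

(** Only [1 + x <= expR x] is used: it gives [expR u * (1 - u) <= 1], to be
    multiplied by [1 + u] when [u >= 0] and compared with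
    [(1 + u + u ^+ 2) * (1 - u) = 1 - u ^+ 3] when [u < 0]. *)
Lemma expR_le_quad u : expR u <= 1 + u + u ^+ 2 * expR (Num.max 0 u).
Proof.
case: (leP 0 u) => u0.
- have e0 : 0 < expR u by exact: expR_gt0.
  have : expR u * (1 - u) <= 1.
    have h := expR_ge1Dx (- u).
    have := ler_wpM2l (ltW e0) h.
    by rewrite expRN divff ?gt_eqF.
  move=> h.
  have h1 : 0 <= (1 - expR u * (1 - u)) * (1 + u) by apply: mulr_ge0; lra.
  nra.
- rewrite expR0 mulr1.
  have h := expR_ge1Dx (- u).
  rewrite expRN in h.
  have e0 : 0 < expR u by exact: expR_gt0.
  have h2 : (1 - u) * expR u <= 1.
    by have := ler_wpM2r (ltW e0) h; rewrite mulVf ?gt_eqF.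
  have h3 : 1 <= (1 + u + u ^+ 2) * (1 - u).
    have : 0 <= - u ^+ 3 by rewrite oppr_ge0 exprSr nmulr_lle0 // ?sqr_ge0.
    rewrite !exprS expr0; nra.
  rewrite -(@ler_pM2r _ (1 - u)); first lra.
  by lra.
Qed.

(** For [- 2 <= l * y] this is [expR x = expR (x / 2) ^+ 2 >= (1 + x / 2) ^+ 2].
    Below [- 2] the affine part is already at most [- 1], which leaves room for
    [l ^+ 2 <= 1].  The truncation at 1 keeps the bound of the form
    [l ^+ 2] times a quantity free of [l], which can be integrated. *)
Lemma expR_ge_quad l y : 0 <= l -> l <= 1 ->
  1 + l * y + l ^+ 2 * Num.min (y ^+ 2 / 4) 1 <= expR (l * y).
Proof.
move=> l0 l1.
have ll : l ^+ 2 <= 1 by rewrite expr_le1.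
have ll0 : 0 <= l ^+ 2 by exact: sqr_ge0.
have m1 : Num.min (y ^+ 2 / 4) 1 <= y ^+ 2 / 4 by rewrite ge_min lexx.
have m2 : Num.min (y ^+ 2 / 4) 1 <= 1 by rewrite ge_min lexx orbT.
set m := Num.min _ _ in m1 m2 *.
case: (leP (- 2) (l * y)) => ly.
- have h := expR_ge1Dx (l * y / 2).
  have -> : expR (l * y) = expR (l * y / 2) ^+ 2.
    by rewrite -expRM_natl; congr expR; field.
  have : (1 + l * y / 2) ^+ 2 <= expR (l * y / 2) ^+ 2.
    rewrite ler_sqr ?nnegrE ?expR_ge0//; lra.
  have : l ^+ 2 * m <= l ^+ 2 * (y ^+ 2 / 4) by exact: ler_wpM2l.
  nra.
- have := expR_ge0 (l * y).
  have : l ^+ 2 * m <= l ^+ 2 * 1 by exact: ler_wpM2l.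
  lra.
Qed.
End exp_bounds.

(** * Products of functions of independent random variables *)

Section independence.
Context {d : measure_display} {T : measurableType d} {R : realType}.
Variable P : probability T R.
Import HBNNSimple.
Local Open Scope ereal_scope.

(** The hypothesis says that the measure of density [H], pushed forward by [Z],
    is [c] times the law of [Z]; equal measures integrate [g] to the same value.
    The equality passes from indicators to simple functions by linearity, and to
    [g] by monotone convergence. *)
Lemma ge0_integral_mul_comp (H : T -> R) (Z : {RV P >-> R}) (c : R)
    (g : R -> R) :
    measurable_fun setT H -> (forall w, 0 <= H w)%R ->
    measurable_fun setT g -> (forall x, 0 <= g x)%R -> (0 <= c)%R ->
    (forall B, measurable B ->
       \int[P]_w (H w * \1_(Z @^-1` B) w)%:E = c%:E * P (Z @^-1` B)) ->
  \int[P]_w (H w * g (Z w))%:E = c%:E * \int[P]_w (g (Z w))%:E.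
Proof.
move=> mH H0 mg g0 c0 HB.
have mgE : measurable_fun [set: R] (fun x : R => (g x)%:E) by exact/measurable_EFinP.
pose f := nnsfun_approx measurableT mgE.
have f0 n x : (0 <= f n x)%R by [].
have mfZ n : measurable_fun setT (f n \o Z) by exact: measurableT_comp.
have fg x : (EFin \o f^~ x) @ \oo --> (g x)%:E.
  by apply: cvg_nnsfun_approx => // y _; rewrite /= lee_fin.
have ndf x : {homo f^~ x : n m / (n <= m)%N >-> (n <= m)%R}.
  by move=> n m nm; exact/lefP/nd_nnsfun_approx.
have lim (K : T -> R) : measurable_fun setT K -> (forall w, 0 <= K w)%R ->
    \int[P]_w (K w * f n (Z w))%:E @[n --> \oo] --> \int[P]_w (K w * g (Z w))%:E.
  move=> mK K0.
  rewrite (_ : (fun w => (K w * g (Z w))%:E) =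
      (fun w => limn (fun n => (K w * f n (Z w))%:E))); last first.
    apply/funext => w; apply/esym/cvg_lim => //.
    under eq_fun do rewrite EFinM.
    by rewrite EFinM; apply: cvgeZl => //; exact: fg.
  apply: cvg_monotone_convergence => //.
  - move=> n; apply/measurable_EFinP; apply: measurable_funM => //.
    exact: mfZ.
  - by move=> n w _; rewrite lee_fin mulr_ge0.
  - move=> w _ n m nm; rewrite lee_fin ler_wpM2l//.
    exact: ndf.
have simple n : \int[P]_w (H w * f n (Z w))%:E = \int[P]_w (c * f n (Z w))%:E.
  have step (K : T -> R) : measurable_fun setT K -> (forall w, 0 <= K w)%R ->
      \int[P]_w (K w * f n (Z w))%:E = \sum_(r \in range (f n))
        r%:E * \int[P]_w (K w * \1_(Z @^-1` (f n @^-1` [set r])) w)%:E.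
    move=> mK K0.
    have mI r : measurable_fun setT (\1_(Z @^-1` (f n @^-1` [set r])) : T -> R).
      apply: measurable_indic; rewrite -[X in measurable X]setTI.
      exact: (measurable_funP Z).
    transitivity (\int[P]_w \sum_(r \in range (f n))
        (r * (K w * \1_(Z @^-1` (f n @^-1` [set r])) w))%:E).
      apply: eq_integral => w _; rewrite fimfunE.
      rewrite fsumEFin//; congr EFin.
      rewrite !fsbig_finite//= mulr_sumr; apply: eq_bigr => r _.
      rewrite mulrCA; congr (_ * (_ * _))%R.
    have pos r w : 0 <= (r * (K w * \1_(Z @^-1` (f n @^-1` [set r])) w))%:E.
      rewrite lee_fin mulrCA mulr_ge0//.
      rewrite indicE; case: (boolP (_ \in _)) => [|_]; last by rewrite mulr0.
      by rewrite inE /= => <-; rewrite mulr1.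
    rewrite ge0_integral_fsum//; last first.
      move=> r; apply/measurable_EFinP.
      by do 2 apply: measurable_funM => //.
    apply: eq_fsbigr => r; rewrite inE => -[x _ <-].
    under eq_integral do rewrite EFinM.
    rewrite ge0_integralZl//.
    - by apply/measurable_EFinP; exact: measurable_funM.
    - by move=> w _; rewrite lee_fin mulr_ge0.
    - by rewrite lee_fin.
  rewrite (step H)// (step (cst c))//.
  apply: eq_fsbigr => r _; congr (_ * _).
  have mB : measurable (f n @^-1` [set r]) by [].
  have mZB : measurable (Z @^-1` (f n @^-1` [set r])).
    by rewrite -[X in measurable X]setTI; exact: (measurable_funP Z).
  rewrite HB//; under eq_integral do rewrite /= EFinM.
  rewrite ge0_integralZl//; last by apply/measurable_EFinP; exact: measurable_indic.
  by rewrite integral_indic// setIT.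
rewrite -ge0_integralZl//; last first.
  - by move=> w _; rewrite lee_fin.
  - by apply/measurable_EFinP; exact: measurableT_comp.
under [RHS]eq_integral do rewrite -EFinM.
have h1 := lim _ mH H0.
have h2 := lim (cst c) (measurable_cst _) (fun=> c0).
have eqf : (fun n => \int[P]_w (H w * f n (Z w))%:E) =
    (fun n => \int[P]_w (c * f n (Z w))%:E) by apply/funext => n; exact: simple.
rewrite eqf in h1.
by apply: cvg_unique h1 h2.
Qed.

(** Independence is given on events, so the indicators of the events are replaced
    by the functions [g i] one index at a time.  The induction needs the mixed
    statement [key], in which the indices below [k] carry functions and a finite
    set [J] of the other indices still carries events. *)
Lemma independent_ge0_integral_prod (X : nat -> {RV P >-> R})
    (g : nat -> R -> R) (k : nat) :
  mutually_independent X ->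
  (forall i, measurable_fun setT (g i)) -> (forall i x, 0 <= g i x)%R ->
  (forall i, \int[P]_w (g i (X i w))%:E < +oo) ->
  \int[P]_w (\prod_(i < k) g i (X i w))%:E =
    \prod_(i < k) \int[P]_w (g i (X i w))%:E.
Proof.
move=> ind mg g0 gfin.
have mgX i : measurable_fun setT (fun w => g i (X i w)) by exact: measurableT_comp.
have mXA i (A : set R) : measurable A -> measurable (X i @^-1` A).
  by move=> mA; rewrite -[X in measurable X]setTI; exact: (measurable_funP (X i)).
have Efin i : \int[P]_w (g i (X i w))%:E \is a fin_num.
  by rewrite ge0_fin_numE// integral_ge0// => w _; rewrite lee_fin.
have key : forall (J : {fset nat}) (A : nat -> set R),
    (forall i, measurable (A i)) -> (forall i, i \in J -> (k <= i)%N) ->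
    \int[P]_w ((\prod_(i < k) g i (X i w)) *
               \1_(\bigcap_(i in [set` J]) (X i @^-1` A i)) w)%:E =
    (\prod_(i < k) \int[P]_w (g i (X i w))%:E) *
      P (\bigcap_(i in [set` J]) (X i @^-1` A i)).
  (* The step applies [ge0_integral_mul_comp] to [Z := X k]; the induction
     hypothesis for [k |` J], with an arbitrary event [B] at [k], is exactly
     its last premise. *)
  elim: k => [|k IH] J A mA Jk.
    under eq_integral do rewrite big_ord0 mul1r.
    rewrite big_ord0 mul1e integral_indic ?setIT//.
    by apply: bigcap_measurableType => *; exact: mXA.
  set E := \bigcap_(i in _) _.
  have mE : measurable E by apply: bigcap_measurableType => *; exact: mXA.
  have kJ : (k \notin J)%fset by apply/negP => /Jk; rewrite ltnn.
  rewrite big_ord_recr/=.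
  have cE : (\prod_(i < k) \int[P]_w (g i (X i w))%:E) \is a fin_num.
    by rewrite prode_fin_num// => i _; exact: Efin.
  have c0 : 0 <= \prod_(i < k) \int[P]_w (g i (X i w))%:E.
    by apply: prode_ge0 => i _; apply: integral_ge0 => w _; rewrite lee_fin.
  pose c := (fine (\prod_(i < k) \int[P]_w (g i (X i w))%:E) * fine (P E))%R.
  have cP : c%:E = (\prod_(i < k) \int[P]_w (g i (X i w))%:E) * P E.
    by rewrite /c EFinM !fineK// fin_num_measure.
  under eq_integral do rewrite big_ord_recr/= mulrAC.
  rewrite muleAC -cP; apply: ge0_integral_mul_comp => //.
  - apply: measurable_funM; first by apply: measurable_prod => i _; exact: mgX.
    exact: measurable_indic.
  - by move=> w; rewrite mulr_ge0// prodr_ge0.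
  - by rewrite mulr_ge0 ?fine_ge0.
  move=> B mB.
  pose A' i := if i == k then B else A i.
  have A'J i : i \in J -> A' i = A i.
    by rewrite /A'; case: eqP => // -> kJ'; rewrite kJ' in kJ.
  have capE : \bigcap_(i in [set` (k |` J)%fset]) (X i @^-1` A' i) =
      E `&` (X k @^-1` B).
    apply/seteqP; split=> [w h|w [Ew Bw] i].
    - split; last by have := h k; rewrite /= /A' eqxx; apply; rewrite !inE eqxx.
      by move=> i iJ; have := h i; rewrite /= (A'J i iJ); apply; rewrite !inE iJ orbT.
    - rewrite /= !inE => /orP[/eqP->|iJ]; first by rewrite /A' eqxx.
      by rewrite (A'J i iJ); exact: Ew.
  have mA' i : measurable (A' i) by rewrite /A'; case: eqP.
  have := IH (k |` J)%fset A' mA'; rewrite capE indicI => IH'.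
  under eq_integral do rewrite -mulrA.
  rewrite IH'; last first.
    by move=> i; rewrite !inE => /orP[/eqP->//|/Jk/ltnW].
  rewrite -capE ind// big_fsetU1//= {1}/A' eqxx cP -muleA; congr (_ * _).
  rewrite muleC [in RHS]/E ind//; congr (_ * _).
  by apply: eq_big_seq => i iJ; rewrite A'J.
have := key fset0 (fun=> setT) (fun=> measurableT) (fun i => ltac:(by rewrite inE)).
rewrite [X in P X](_ : _ = setT) ?probability_setT ?mule1; last first.
  by apply/seteqP; split => // w _ i; rewrite /= inE.
move=> <-; apply: eq_integral => w _.
rewrite indicE mem_set ?mulr1// => i; by rewrite /= inE.
Qed.

End independence.

(** * The moment generating function near 0 *)

Section moments.
Context {d : measure_display} {T : measurableType d} {R : realType}.
Variable P : probability T R.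
Local Open Scope ereal_scope.

Lemma integral_affine2 (f g : T -> R) (a b : R) :
    P.-integrable setT (EFin \o f) -> P.-integrable setT (EFin \o g) ->
  P.-integrable setT (fun w => (1 + a * f w + b * g w)%:E) /\
  \int[P]_w (1 + a * f w + b * g w)%:E =
    1 + a%:E * \int[P]_w (f w)%:E + b%:E * \int[P]_w (g w)%:E.
Proof.
move=> If Ig.
have I1 : P.-integrable setT (EFin \o cst 1%R : T -> \bar R).
  exact: finite_measure_integrable_cst.
have Iaf : P.-integrable setT (EFin \o (fun w => a * f w)%R).
  by rewrite (_ : _ \o _ = fun w => a%:E * (EFin \o f) w) //; exact: integrableZl.
have Ibg : P.-integrable setT (EFin \o (fun w => b * g w)%R).
  by rewrite (_ : _ \o _ = fun w => b%:E * (EFin \o g) w) //; exact: integrableZl.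
have I1a : P.-integrable setT (EFin \o (fun w => 1 + a * f w)%R).
  by rewrite (_ : _ \o _ = (EFin \o cst 1%R) \+ (EFin \o (fun w => a * f w)%R)) //;
    exact: integrableD.
split.
  by rewrite (_ : (fun w => _) = (EFin \o (fun w => 1 + a * f w)%R) \+
    (EFin \o (fun w => b * g w)%R)) //; exact: integrableD.
transitivity (\int[P]_w ((EFin \o (fun w => 1 + a * f w)%R) \+
    (EFin \o (fun w => b * g w)%R)) w); first exact: eq_integral.
rewrite integralD_EFin//; congr (_ + _).
  transitivity (\int[P]_w ((EFin \o cst 1%R) \+
    (EFin \o (fun w => a * f w)%R)) w); first exact: eq_integral.
  rewrite integralD_EFin//; congr (_ + _).
    rewrite /= integral_cst// mul1e; exact: probability_setT. 
  by under eq_integral do rewrite /= EFinM; rewrite integralZl.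
by under eq_integral do rewrite /= EFinM; rewrite integralZl.
Qed.

Variable Y : T -> R.
Hypothesis mY : measurable_fun setT Y.
Hypothesis Y2_lty : \int[P]_w (Y w ^+ 2)%:E < +oo.

Let mY2 : measurable_fun setT (fun w => Y w ^+ 2)%R.
Proof. exact: measurable_funX. Qed.

Let iY2 : P.-integrable setT (EFin \o (fun w => Y w ^+ 2)%R).
Proof.
apply/integrableP; split; first exact/measurable_EFinP.
by under eq_integral do rewrite /= ger0_norm ?sqr_ge0//.
Qed.

Lemma sqr_integrable_integrable : P.-integrable setT (EFin \o Y).
Proof.
have [I _] := integral_affine2 0 1 iY2 iY2.
apply: le_integrable I => //; first exact/measurable_EFinP.
move=> w _; rewrite /= lee_fin mul0r addr0 mul1r.
rewrite [leRHS]ger0_norm; last by rewrite addr_ge0// sqr_ge0.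
have := sqr_ge0 (`|Y w| - 1)%R; have := normr_ge0 (Y w).
rewrite -(real_normK (num_real (Y w))); nra.
Qed.

Hypothesis EY : \int[P]_w (Y w)%:E = 0.

(** The linear term of [expR_le_quad] has mean 0.  The factor
    [expR (Num.max 0 (l * Y))] of the quadratic term is at most
    [expR (L * Num.max 0 M)] because [Y] is bounded above. *)
Lemma mgf_le_quad (M L : R) : {ae P, forall w, Y w <= M}%R -> (0 <= L)%R ->
  exists2 C : R, (0 <= C)%R & forall l : R, (0 <= l)%R -> (l <= L)%R ->
    \int[P]_w (expR (l * Y w))%:E <= (1 + C * l ^+ 2)%:E.
Proof.
move=> YM L0; pose K := expR (L * Num.max 0 M)%R.
have K1 : (1 <= K)%R.
  by rewrite /K -expR0 ler_expR mulr_ge0// le_max lexx.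
exists (K * fine (\int[P]_w (Y w ^+ 2)%:E))%R.
  by rewrite mulr_ge0 ?(le_trans _ K1)// fine_ge0// integral_ge0// => w _;
    rewrite lee_fin sqr_ge0.
move=> l l0 lL.
have [I E] := integral_affine2 l (l ^+ 2 * K)%R sqr_integrable_integrable iY2.
rewrite EY mule0 adde0 in E.
rewrite EFinD mulrC [(K * _)%R]mulrC mulrA mulrAC EFinM fineK; last first.
  by rewrite ge0_fin_numE// integral_ge0// => w _; rewrite lee_fin sqr_ge0.
rewrite -E; apply: ae_ge0_le_integral => //.
- apply/measurable_EFinP; apply: measurableT_comp => //.
  exact: measurable_funM.
- move=> w _; rewrite lee_fin.
  have := sqr_ge0 (l * Y w)%R.
  have : (0 <= (l * Y w) ^+ 2 * (K - 1))%R by rewrite mulr_ge0 ?sqr_ge0 ?subr_ge0.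
  (* With [u = l * Y w] and [K >= 1], [1 + u + K * u ^+ 2 >= 1 + u + u ^+ 2 > 0]. *)
  have := sqr_ge0 (1 + l * Y w)%R.
  by rewrite !exprMn; nra.
- by case/integrableP: I.
apply: filterS YM => w YwM _; rewrite lee_fin.
apply: le_trans (expR_le_quad _) _; rewrite lerD2l.
rewrite exprMn mulrAC ler_wpM2r ?sqr_ge0// ler_wpM2l ?sqr_ge0//.
rewrite ler_expR ge_max mulr_ge0 ?le_max ?lexx//=.
apply: (@le_trans _ _ (l * Num.max 0 M)%R).
  by rewrite ler_wpM2l// le_max YwM orbT.
by rewrite ler_wpM2r// le_max lexx.
Qed.

(** Here [c] is the mean of [Num.min (Y ^+ 2 / 4) 1], which is positive because
    it vanishes only if [Y = 0] almost surely. *)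
Lemma mgf_ge_quad : 0 < \int[P]_w (Y w ^+ 2)%:E ->
  exists2 c : R, (0 < c)%R & forall l : R, (0 <= l)%R -> (l <= 1)%R ->
    (1 + c * l ^+ 2)%:E <= \int[P]_w (expR (l * Y w))%:E.
Proof.
move=> Y2_gt0; pose m w := Num.min (Y w ^+ 2 / 4)%R 1%R.
have m0 w : (0 <= m w)%R by rewrite le_min ler01 andbT mulr_ge0 ?sqr_ge0.
have mm : measurable_fun setT m.
  apply: measurable_minr => //; exact: measurable_funM.
have Im : P.-integrable setT (EFin \o m).
  have I1 : P.-integrable setT (EFin \o cst 1%R : T -> \bar R).
    exact: finite_measure_integrable_cst.
  apply: le_integrable I1 => //; first exact/measurable_EFinP.
  move=> w _; rewrite /= lee_fin (ger0_norm (m0 w)) ger0_norm//.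
  by rewrite ge_min lexx orbT.
have em0 : 0 <= \int[P]_w (m w)%:E by apply: integral_ge0 => w _; rewrite lee_fin.
have emfin : \int[P]_w (m w)%:E \is a fin_num.
  by apply: integrable_fin_num.
exists (fine (\int[P]_w (m w)%:E))%R.
  rewrite fine_gt0// -ge0_fin_numE// emfin andbT lt_neqAle em0 andbT eq_sym.
  apply/negP => /eqP m00.
  have : \int[P]_w `|(EFin \o m) w| = 0.
    by rewrite -m00; apply: eq_integral => w _; rewrite /= ger0_norm.
  move=> /(ae_eq_integral_abs P measurableT _).1 aem.
  have : \int[P]_w (Y w ^+ 2)%:E = 0.
    rewrite -[RHS](integral0 P setT); apply: ae_eq_integral => //.
      exact/measurable_EFinP.
    apply: filterS (aem _); last exact/measurable_EFinP.
    move=> w /(_ Logic.I) [] mw _; rewrite /cst/=; congr EFin; move: mw.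
    have := sqr_ge0 (Y w).
    by rewrite /m; case: (leP (Y w ^+ 2 / 4)%R 1%R) => _ yw m1; lra.
  by move=> Y20; rewrite Y20 ltxx in Y2_gt0.
move=> l l0 l1.
have [I E] := integral_affine2 l (l ^+ 2)%R sqr_integrable_integrable Im.
rewrite EY mule0 adde0 in E.
rewrite EFinD mulrC EFinM fineK// -E.
have [Ifin|] := boolP (\int[P]_w (expR (l * Y w))%:E < +oo); last first.
  by rewrite -leNgt leye_eq => /eqP ->; exact: leey.
apply: le_integral => //.
  apply/integrableP; split.
    apply/measurable_EFinP; apply: measurableT_comp => //.
    exact: measurable_funM.
  by under eq_integral do rewrite /= ger0_norm ?expR_ge0//.
by move=> w _; rewrite lee_fin; exact: expR_ge_quad.
Qed.

End moments.

(** * The logarithm as a real-valued random variable *)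

Section log_variable.
Context {d : measure_display} {T : measurableType d} {R : realType}.
Variable P : probability T R.
Variable Z : {RV P >-> R}.
Local Open Scope ereal_scope.

(** A finite second moment forbids [lne = - oo] on a set of positive measure, so
    [Z > 0] almost surely and the two logarithms can be exchanged. *)
Lemma lne_moments : \int[P]_w (lne (Z w)%:E ^+ 2) < +oo ->
  [/\ {ae P, forall w, (0 < Z w)%R},
      \int[P]_w (ln (Z w))%:E = \int[P]_w lne (Z w)%:E &
      \int[P]_w (ln (Z w) ^+ 2)%:E = \int[P]_w (lne (Z w)%:E ^+ 2)].
Proof.
move=> h.
have mZ : measurable_fun setT Z by exact: measurable_funP.
have mlnZ : measurable_fun setT (fun w => ln (Z w)).
  by apply: measurableT_comp mZ; exact: measurable_ln.
have mL : measurable_fun setT (fun w => lne (Z w)%:E).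
  rewrite /lne; apply: measurable_fun_ifT => //.
  - apply: measurable_fun_ler => //.
  - exact/measurable_EFinP.
have mL2 : measurable_fun setT (fun w => lne (Z w)%:E ^+ 2).
  by under eq_fun do rewrite expe2; exact: emeasurable_funM.
have L20 w : 0 <= lne (Z w)%:E ^+ 2 by exact: sqre_ge0.
have I : P.-integrable setT (fun w => lne (Z w)%:E ^+ 2).
  apply/integrableP; split => //.
  by under eq_integral do rewrite gee0_abs//.
have pos : {ae P, forall w, (0 < Z w)%R}.
  apply: filterS (integrable_ae measurableT I) => w /(_ Logic.I).
  by rewrite /lne; case: leP.
split => //.
- apply: ae_eq_integral => //; first exact/measurable_EFinP.
  by apply: filterS pos => w w0 _; rewrite lne_EFin.
- apply: ae_eq_integral => //; first by apply/measurable_EFinP; exact: measurable_funX.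
  by apply: filterS pos => w w0 _; rewrite lne_EFin// expe2 -EFinM expr2.
Qed.

End log_variable.

(** * Fractional moments of the weights *)

Section weight_moments.
Context {d : measure_display} {T : measurableType d} {R : realType}.
Variable P : probability T R.
Local Open Scope ereal_scope.

Lemma identically_distributed_ge0_integral (X : nat -> {RV P >-> R})
    (g : R -> R) (n : nat) :
    identically_distributed X -> measurable_fun setT g ->
    (forall x, 0 <= g x)%R ->
  \int[P]_w (g (X n w))%:E = \int[P]_w (g (X 0%N w))%:E.
Proof.
move=> idX mg g0.
have mgE : measurable_fun [set: R] (fun x : R => (g x)%:E) by exact/measurable_EFinP.
have gE0 (x : R) : 0 <= (g x)%:E by rewrite lee_fin.
rewrite -(ge0_integral_distribution (X n) mgE gE0).
rewrite -(ge0_integral_distribution (X 0%N) mgE gE0).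
by apply: eq_measure_integral => A mA _; exact: idX.
Qed.

Lemma powR_prod_ord (n : nat) (x : nat -> R) (l : R) : (forall i, 0 <= x i)%R ->
  ((\prod_(i < n) x i) `^ l = \prod_(i < n) x i `^ l)%R.
Proof.
move=> x0; elim: n => [|n IH]; first by rewrite !big_ord0 powR1.
by rewrite !big_ord_recr/= powRM ?IH// prodr_ge0.
Qed.

Variable X : nat -> {RV P >-> R}.
Hypothesis X_ge0 : forall n, {ae P, forall w, 0 <= X n w}%R.
Hypothesis X_iid : iid X.

Lemma measurable_weight n : measurable_fun setT (weight X n).
Proof.
by rewrite /weight; apply: measurable_prod => i _; exact: measurable_funP.
Qed.

Lemma measurable_weight_powR n l : measurable_fun setT (fun w => weight X n w `^ l)%R.
Proof.
exact: (measurableT_comp (measurable_powR l) (measurable_weight n)).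
Qed.

Lemma ae_weight_ge0 : {ae P, forall w, forall n, 0 <= weight X n w}%R.
Proof.
have := @ae_foralln _ _ _ P (fun n w => 0 <= X n w)%R X_ge0.
apply: filterS => w Xw n.
by apply: prodr_ge0 => i _; exact: Xw.
Qed.

Lemma integral_weight_powR n (l m : R) :
    \int[P]_w (X 0%N w `^ l)%:E = m%:E ->
  \int[P]_w (weight X n w `^ l)%:E = (m ^+ n)%:E.
Proof.
move=> Xm; have [indX idX] := X_iid.
have mpow : measurable_fun setT (fun x : R => x `^ l)%R by exact: measurable_powR.
have Xim i : \int[P]_w (X i w `^ l)%:E = m%:E.
  rewrite -Xm (identically_distributed_ge0_integral _ idX mpow)// => x.
  exact: powR_ge0.
transitivity (\int[P]_w (\prod_(i < n) (X i w `^ l)%R)%:E).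
  apply: ae_eq_integral => //.
  - by apply/measurable_EFinP; exact: measurable_weight_powR.
  - apply/measurable_EFinP; apply: measurable_prod => i _.
    apply: (measurableT_comp (measurable_powR l)).
    exact: measurable_funP.
  - have := @ae_foralln _ _ _ P (fun n w => 0 <= X n w)%R X_ge0.
    apply: filterS => w Xw _; congr EFin.
    by rewrite /weight (powR_prod_ord n l Xw).
rewrite (@independent_ge0_integral_prod _ _ _ P X (fun _ x => x `^ l)%R)//; first last.
- by move=> i; rewrite Xim ltry.
- by move=> i x; exact: powR_ge0.
under eq_bigr do rewrite Xim.
by rewrite prodEFin prodr_const card_ord.
Qed.

Variable M : R.
Hypothesis X_leM : {ae P, forall w, X 0%N w <= M}%R.
Hypothesis EX_ln : \int[P]_w lne (X 0%N w)%:E = 0.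
Hypothesis EX_ln2_fin : \int[P]_w (lne (X 0%N w)%:E ^+ 2) < +oo.

Let mlnX : measurable_fun setT (fun w => ln (X 0%N w)).
Proof. by apply: measurableT_comp => //; exact: measurable_ln. Qed.

Let powR_expR l : \int[P]_w (X 0%N w `^ l)%:E = \int[P]_w (expR (l * ln (X 0%N w)))%:E.
Proof.
have [pos _ _] := lne_moments EX_ln2_fin.
apply: ae_eq_integral => //.
- apply/measurable_EFinP; apply: (measurableT_comp (measurable_powR l)).
  exact: measurable_funP.
- by apply/measurable_EFinP; apply: measurableT_comp => //; exact: measurable_funM.
- apply: filterS pos => w w0 _; congr EFin.
  by rewrite /powR gt_eqF.
Qed.

Let EX_lnR : \int[P]_w (ln (X 0%N w))%:E = 0.
Proof. by have [_ -> _] := lne_moments EX_ln2_fin. Qed.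

Let EX_ln2R : \int[P]_w (ln (X 0%N w) ^+ 2)%:E < +oo.
Proof. by have [_ _ ->] := lne_moments EX_ln2_fin. Qed.

Let moment_le (K : R) : (0 <= K)%R ->
  exists2 C : R, (0 <= C)%R & forall l, (0 <= l)%R -> (l <= K)%R ->
    exists2 m : R, \int[P]_w (X 0%N w `^ l)%:E = m%:E &
                   (0 <= m <= 1 + C * l ^+ 2)%R.
Proof.
move=> K0.
have lnXM : {ae P, forall w, ln (X 0%N w) <= ln M}%R.
  have [pos _ _] := lne_moments EX_ln2_fin.
  apply: filterS2 X_leM pos => w XwM Xw0.
  by rewrite ler_ln// posrE// (lt_le_trans Xw0).
have [C C0 HC] := mgf_le_quad mlnX EX_ln2R EX_lnR lnXM K0.
exists C => // l l0 lK.
have h := HC l l0 lK; rewrite -powR_expR in h.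
have E0 : 0 <= \int[P]_w (X 0%N w `^ l)%:E.
  by apply: integral_ge0 => w _; rewrite lee_fin powR_ge0.
have Efin : \int[P]_w (X 0%N w `^ l)%:E \is a fin_num.
  by rewrite ge0_fin_numE// (le_lt_trans h)// ltry.
exists (fine (\int[P]_w (X 0%N w `^ l)%:E)); first by rewrite fineK.
by rewrite fine_ge0//= -lee_fin fineK.
Qed.

Let sqrt_ge1 n : (1 <= Num.sqrt n.+1%:R :> R)%R.
Proof. by rewrite -[leLHS]sqrtr1 ler_sqrt// ler1n. Qed.

Let sqrt_gt0 n : (0 < Num.sqrt n.+1%:R :> R)%R.
Proof. exact: lt_le_trans (sqrt_ge1 n). Qed.

(** [(1 + C * (K ^+ 2 / n)) ^+ n <= expR (C * K ^+ 2)].  At [n = 0] the exponent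
    is [K / 0 = 0] and both the weight and its power are 1. *)
Lemma integral_weight_powR_sqrt_le (K : R) : (0 <= K)%R ->
  exists2 B : R, (0 < B)%R & forall n,
    \int[P]_w (weight X n w `^ (K / Num.sqrt n%:R))%:E <= B%:E.
Proof.
move=> K0; have [C C0 HC] := moment_le K0.
exists (expR (C * K ^+ 2)) => [|n]; first exact: expR_gt0.
case: n => [|n].
  rewrite sqrtr0 invr0 mulr0.
  rewrite (@integral_weight_powR 0 0 1) ?expr0.
    by rewrite lee_fin -expR0 ler_expR mulr_ge0// sqr_ge0.
  under eq_integral do rewrite powRr0.
  by rewrite integral_cst// mul1e; exact: probability_setT.
set l := (K / _)%R.
have l0 : (0 <= l)%R by rewrite divr_ge0// ltW.
have lK : (l <= K)%R by rewrite ler_pdivrMr// ler_peMr.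
have [m mE /andP[m0 mC]] := HC l l0 lK.
rewrite (integral_weight_powR n.+1 mE) lee_fin.
apply: (@le_trans _ _ (expR (C * l ^+ 2) ^+ n.+1)%R).
  by rewrite lerXn2r ?nnegrE ?expR_ge0// (le_trans mC)// expR_ge1Dx.
rewrite -expRM_natl ler_expR /l expr_div_n sqr_sqrtr//.
have : n.+1%:R != 0%R :> R by rewrite pnatr_eq0.
move: (n.+1%:R) => N N0.
by rewrite (_ : (N * _)%R = (C * K ^+ 2)%R)//; field.
Qed.

(** Bernoulli's inequality: [(1 + c / n) ^+ n >= 1 + c]. *)
Lemma integral_weight_powR_sqrt_ge :
    0 < \int[P]_w (lne (X 0%N w)%:E ^+ 2) ->
  exists2 c : R, (0 < c)%R & forall n, (0 < n)%N ->
    (1 + c)%:E <= \int[P]_w (weight X n w `^ (Num.sqrt n%:R)^-1)%:E.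
Proof.
have [_ _ <-] := lne_moments EX_ln2_fin => EX_ln2_gt0.
have [c c0 Hc] := mgf_ge_quad mlnX EX_ln2R EX_lnR EX_ln2_gt0.
have [C _ HC] := moment_le ler01.
exists c => // -[//|n] _; set l := (_^-1)%R.
have l0 : (0 <= l)%R by rewrite invr_ge0 ltW.
have l1 : (l <= 1)%R by rewrite invf_le1.
have [m mE _] := HC l l0 l1.
have h := Hc l l0 l1; rewrite -powR_expR mE lee_fin in h.
rewrite (integral_weight_powR n.+1 mE) lee_fin.
have cl0 : (0 <= c * l ^+ 2)%R by rewrite mulr_ge0 ?sqr_ge0// ltW.
have bernoulli (x : R) k : (0 <= x)%R -> (1 + k%:R * x <= (1 + x) ^+ k)%R.
  move=> x0; elim: k => [|k IH]; first by rewrite mul0r addr0 expr0.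
  rewrite exprS; apply: le_trans (ler_wpM2l _ IH); last by rewrite addr_ge0.
  have : (0 <= k%:R * x ^+ 2)%R by rewrite mulr_ge0 ?sqr_ge0.
  by rewrite -natr1; nra.
apply: le_trans (lerXn2r n.+1 _ _ h); rewrite ?nnegrE ?addr_ge0//; last first.
  by apply: le_trans h; rewrite addr_ge0.
apply: le_trans (bernoulli _ _ cl0); rewrite lerD2l.
by rewrite /l exprVn sqr_sqrtr// mulrCA divff ?mulr1// pnatr_eq0.
Qed.
End weight_moments.

(** * Series of nonnegative terms *)

Section series_lemmas.
Context {R : realType}.
Local Open Scope ereal_scope.

Lemma near_le_nneseries_lty (u v : nat -> R) :
    (forall n, 0 <= u n)%R -> (forall n, 0 <= v n)%R ->
    (\forall n \near \oo, (u n <= v n)%R) ->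
    \sum_(0 <= n <oo) (v n)%:E < +oo ->
  \sum_(0 <= n <oo) (u n)%:E < +oo.
Proof.
move=> u0 v0 [N _ uv] vfin.
rewrite (nneseries_split 0 N) => [|k _]; last by rewrite lee_fin.
rewrite add0n lte_add_pinfty// ?sumEFin ?ltry//.
apply: le_lt_trans vfin.
rewrite [leRHS](nneseries_split 0 N) => [|k _]; last by rewrite lee_fin.
rewrite add0n !(eseries_cond _ _ N) sumEFin.
apply: (@le_trans _ _ (\sum_(i <oo | true && (N <= i)%N) (v i)%:E)).
  by apply: lee_nneseries => [i _ _|i Ni]; rewrite lee_fin//; exact: uv.
by rewrite leeDr// lee_fin sumr_ge0.
Qed.

(** A summable sequence of the order of [n ^- 2] whose partial sums telescope,
    see [pronic_invE] and [nneseries_pronic_inv_le1]. *)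
Definition pronic_inv (n : nat) : R := (n.+1%:R^-1 - n.+2%:R^-1)%R.

Lemma pronic_invE (n : nat) :
  pronic_inv n = ((n%:R + 1) * (n%:R + 2))^-1%R.
Proof.
have N0 : (0 <= n%:R :> R)%R by exact: ler0n.
rewrite /pronic_inv -[n.+2]addn2 -[n.+1]addn1 !natrD; field.
by apply/andP; split; rewrite gt_eqF//; lra.
Qed.

Lemma pronic_inv_ge0 (n : nat) : (0 <= pronic_inv n)%R.
Proof. by rewrite subr_ge0 lef_pV2 ?posrE// ler_nat. Qed.

Lemma nneseries_pronic_inv_le1 :
  \sum_(0 <= n <oo) (pronic_inv n)%:E <= 1.
Proof.
have term_ge0 n : 0 <= (pronic_inv n)%:E by rewrite lee_fin pronic_inv_ge0.
apply: lime_le; first by apply: is_cvg_nneseries.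
apply: nearW => n; rewrite sumEFin lee_fin.
have -> : (\sum_(0 <= k < n) pronic_inv k = 1 - n.+1%:R^-1 :> R)%R.
  elim: n => [|n IH]; first by rewrite big_geq// invr1 subrr.
  by rewrite big_nat_recr//= IH /pronic_inv addrA subrK.
by rewrite gerBl.
Qed.

Lemma nneseries_lty_near_le1 (u : nat -> R) : (forall n, 0 <= u n)%R ->
  \sum_(0 <= n <oo) (u n)%:E < +oo -> \forall n \near \oo, (u n <= 1)%R.
Proof.
move=> u0 /(nnseries_is_cvg u0) /cvg_series_cvg_0 /cvgrPdist_le.
move=> /(_ 1%R ltr01); apply: filterS => n.
by rewrite sub0r normrN ger0_norm.
Qed.

End series_lemmas.

(** * Comparing the coefficients with the weights *)

Section coefficients.
Context {R : realType}.
Implicit Types (alpha : R) (n : nat).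

Lemma normc_fcoef alpha n : (0 < n)%N ->
  ComplexField.Normc.normc (fcoef alpha n) = n%:R `^ (- n%:R `^ alpha).
Proof.
move=> n0; rewrite /fcoef gtn_eqF// powRN /=.
by rewrite expr0n/= addr0 sqrtr_sqr ger0_norm// invr_ge0 powR_ge0.
Qed.

(** The hypothesis gives [Q n `^ (6 / sqrt n) <= (n + 1) (n + 2) <= n ^+ 3]; raised
    to the power [sqrt n / 3] it reads [Q n ^+ 2 <= n `^ (sqrt n)], half of the
    decay [n `^ (- 2 * sqrt n)] of the squared coefficient.  What is left,
    [n `^ (- sqrt n)], is at most [n `^ (- 3)] as soon as [n >= 9].  The exponent 6
    is twice 3, the degree of the power of [n] that dominates [(n + 1) (n + 2)]. *)
Lemma near_fcoef_weight_le alpha (Q : nat -> R) : 2^-1 <= alpha ->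
    (forall n, 0 <= Q n) ->
    (\forall n \near \oo,
      Q n `^ (6 / Num.sqrt n%:R) * pronic_inv n <= 1) ->
  \forall n \near \oo,
    ComplexField.Normc.normc (fcoef alpha n) ^+ 2 * Q n ^+ 2
      <= pronic_inv n :> R.
Proof.
move=> alpha2 Q0 H; near=> n.
have n9 : (9 <= n)%N by near: n; exists 9%N.
have n0 : (0 < n)%N by exact: leq_trans n9.
have H1 : Q n `^ (6 / Num.sqrt n%:R) * pronic_inv n <= 1 by near: n.
set s : R := Num.sqrt n%:R in H1 *.
have N9 : 9 <= n%:R :> R by rewrite ler_nat.
have s3 : 3 <= s.
  have -> : 3 = Num.sqrt (3 ^+ 2) :> R by rewrite sqrtr_sqr ger0_norm.
  by rewrite ler_sqrt// (le_trans _ N9)//; lra.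
have N0 : 0 < n%:R :> R by rewrite ltr0n.
have N1 : 1 <= n%:R :> R by rewrite ler1n.
have t3 : (n%:R : R) `^ (- 3) <= pronic_inv n :> R.
  rewrite pronic_invE powRN powR_mulrn ?ler0n// lef_pV2 ?posrE; last 2 first.
  - by rewrite exprn_gt0.
  - by rewrite mulr_gt0//; lra.
  by rewrite !exprS expr0; nra.
have Q3 : Q n `^ (6 / s) <= n%:R `^ 3.
  rewrite pronic_invE ler_pdivrMr ?mul1r in H1; last by rewrite mulr_gt0//; lra.
  apply: le_trans H1 _; rewrite powR_mulrn ?ler0n//.
  by rewrite !exprS expr0; nra.
have Q2 : Q n ^+ 2 <= n%:R `^ s.
  have -> : Q n ^+ 2 = (Q n `^ (6 / s)) `^ (s / 3).
    rewrite -powRrM (_ : 6 / s * (s / 3) = 2); last by field; lra.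
    by rewrite -powR_mulrn.
  have -> : n%:R `^ s = (n%:R `^ 3) `^ (s / 3).
    by rewrite -powRrM; congr (_ `^ _); field.
  apply: ge0_ler_powR => //; rewrite ?nnegrE ?powR_ge0//.
  by apply: divr_ge0 => //; lra.
rewrite normc_fcoef//.
apply: le_trans t3; apply: (@le_trans _ _ (n%:R `^ (- s))); last first.
  by apply: ler_powR => //; lra.
have -> : - s = (- s) *+ 2 + s by rewrite mulr2n; ring.
rewrite powRD; last by rewrite pnatr_eq0 -lt0n n0 implybT.
apply: ler_pM => //; rewrite ?sqr_ge0//.
rewrite -[(- s) *+ 2]mulr_natr powRrM powR_mulrn ?powR_ge0// ler_sqr ?nnegrE ?powR_ge0//.
apply: ler_powR => //; rewrite lerN2 /s -powR12_sqrt ?ler0n//.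
exact: ler_powR.
Unshelve. all: by end_near. Qed.

Lemma powR_natN_cvg0 (e : R) : 0 < e -> n%:R `^ (- e) @[n --> \oo] --> (0 : R).
Proof.
move=> e0; apply/cvgrPdist_le => /= eps eps0; near=> n.
rewrite sub0r normrN ger0_norm ?powR_ge0//.
have n0 : 0 < n%:R :> R by rewrite ltr0n; near: n; exists 1%N.
have h : eps^-1 `^ e^-1 <= n%:R.
  by near: n; exact: nbhs_infty_ger.
rewrite powRN invf_ple ?posrE ?powR_gt0//.
have -> : eps^-1 = (eps^-1 `^ e^-1) `^ e.
  by rewrite -powRrM mulVf ?gt_eqF// powRr1// invr_ge0 ltW.
by apply: ge0_ler_powR; rewrite ?nnegrE ?powR_ge0// ltW.
Unshelve. all: by end_near. Qed.

(** With [e = (2^-1 - alpha) / 2], the logarithm of the left-hand side is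
    [n `^ (- e) * n `^ (- e) * ln n], and [e * ln n = ln (n `^ e) <= n `^ e] bounds
    it by [n `^ (- e) / e]. *)
Lemma powR_nat_powR_sqrt_cvg1 alpha : alpha < 2^-1 ->
  n%:R `^ (n%:R `^ alpha / Num.sqrt n%:R) @[n --> \oo] --> (1 : R).
Proof.
move=> a2; pose e := (2^-1 - alpha) / 2.
have e0 : 0 < e by rewrite /e; lra.
have expo : n%:R `^ (- e) / e @[n --> \oo] --> (0 : R).
  by rewrite -[0](mul0r e^-1); apply: cvgMl; exact: powR_natN_cvg0.
have up : expR (n%:R `^ (- e) / e) @[n --> \oo] --> (1 : R).
  have := cvg_comp _ _ expo (@continuous_expR R 0).
  by rewrite expR0.
apply: (@squeeze_cvgr _ _ _ _ (fun=> 1) _ _ _ _ _ up); last exact: cvg_cst.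
near=> n.
have n0 : 0 < n%:R :> R by rewrite ltr0n; near: n; exists 1%N.
have n1 : 1 <= n%:R :> R by rewrite ler1n -(ltr0n R).
have ln0 : 0 <= ln (n%:R : R) by exact: ln_ge0.
have n_neq0 b : b ==> (n%:R != 0 :> R) by rewrite gt_eqF// implybT.
have -> : n%:R `^ alpha / Num.sqrt n%:R = n%:R `^ (- e) * n%:R `^ (- e).
  rewrite -powR12_sqrt ?ltW// -powRN -!powRD//; congr (_ `^ _).
  by rewrite /e; field.
have -> (x : R) : n%:R `^ x = expR (x * ln n%:R) by rewrite /powR gt_eqF.
rewrite ler_expR -[leLHS]expR0 ler_expR; apply/andP; split.
  by rewrite mulr_ge0// mulr_ge0// expR_ge0.
rewrite -mulrA ler_wpM2l ?powR_ge0// -(ler_pM2l e0) mulrCA -ln_powR mulfV ?gt_eqF//.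
rewrite powRN mulrC ler_pdivrMr ?powR_gt0// mul1r ltW// ln_sublinear//.
exact: powR_gt0.
Unshelve. all: by end_near. Qed.

(** A term at most 1 means [q n <= n `^ (n `^ alpha)], by the value of the
    coefficient; take the power [1 / sqrt n]. *)
Lemma near_powR_sqrt_le alpha (q : nat -> R) : (forall n, 0 <= q n) ->
    (\forall n \near \oo,
      ComplexField.Normc.normc (fcoef alpha n) ^+ 2 * q n ^+ 2 <= 1) ->
  \forall n \near \oo,
    q n `^ (Num.sqrt n%:R)^-1 <= n%:R `^ (n%:R `^ alpha / Num.sqrt n%:R).
Proof.
move=> q0 H; near=> n.
have n0 : (0 < n)%N by near: n; exists 1%N.
have N0 : 0 < n%:R :> R by rewrite ltr0n.
have : ComplexField.Normc.normc (fcoef alpha n) ^+ 2 * q n ^+ 2 <= 1.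
  by near: n.
rewrite normc_fcoef// -exprMn expr_le1 ?mulr_ge0 ?powR_ge0//.
rewrite powRN ler_pdivrMl ?powR_gt0// mulr1 => qn.
rewrite [leRHS]powRrM; apply: ge0_ler_powR => //; rewrite ?nnegrE ?powR_ge0//.
Unshelve. all: by end_near. Qed.

End coefficients.

(** * Membership in the random Hardy space *)

Section membership.
Context {d : measure_display} {T : measurableType d} {R : realType}.
Variable P : probability T R.
Local Open Scope ereal_scope.

Variable X : nat -> {RV P >-> R}.
Hypothesis X_ge0 : forall n, {ae P, forall w, 0 <= X n w}%R.

(** A series of nonnegative random variables with summable expectations converges
    almost surely; applied to [weight X n `^ (6 / sqrt n) * pronic_inv n]. *)
Lemma hardy_star_of_moment_bound (alpha B : R) : (2^-1 <= alpha)%R ->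
    (forall n, \int[P]_w (weight X n w `^ (6 / Num.sqrt n%:R))%:E <= B%:E) ->
  hardy_star X (fcoef alpha).
Proof.
move=> alpha2 HB.
pose t := @pronic_inv R.
have t0 n : (0 <= t n)%R by exact: pronic_inv_ge0.
pose Z n w := (weight X n w `^ (6 / Num.sqrt n%:R) * t n)%R.
have Z0 n w : (0 <= Z n w)%R by rewrite mulr_ge0// powR_ge0.
have mZ n : measurable_fun setT (fun w => (Z n w)%:E).
  apply/measurable_EFinP; apply: measurable_funM => //.
  exact: measurable_weight_powR.
have B0 : (0 <= B)%R.
  rewrite -lee_fin (le_trans _ (HB 0%N))// integral_ge0// => w _.
  by rewrite lee_fin powR_ge0.
have intZ n : \int[P]_w (Z n w)%:E <= B%:E * (t n)%:E.
  under eq_integral do rewrite EFinM muleC.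
  rewrite ge0_integralZl//.
  - by rewrite muleC lee_wpmul2r// lee_fin.
  - by apply/measurable_EFinP; exact: measurable_weight_powR.
  - by move=> w _; rewrite lee_fin powR_ge0.
  - by rewrite lee_fin.
pose S w := \sum_(0 <= n <oo) (Z n w)%:E.
have S0 w : 0 <= S w by apply: nneseries_ge0 => k _ _; rewrite lee_fin.
have mS : measurable_fun setT S.
  by apply: ge0_emeasurable_sum => // k x _ _; rewrite lee_fin.
have iS : P.-integrable setT S.
  apply/integrableP; split => //.
  under eq_integral do rewrite gee0_abs//.
  rewrite /S integral_nneseries//; last by move=> k x _; rewrite lee_fin.
  apply: (@le_lt_trans _ _ (\sum_(0 <= n <oo) (B%:E * (t n)%:E))).
    apply: lee_nneseries => [k _ _|k _]; last exact: intZ.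
    by apply: integral_ge0 => w _; rewrite lee_fin.
  rewrite nneseriesZl//; last by move=> k _; rewrite lee_fin.
  apply: (@le_lt_trans _ _ (B%:E * 1)); last by rewrite mule1 ltry.
  by rewrite lee_wpmul2l ?lee_fin//; exact: nneseries_pronic_inv_le1.
apply: filterS2 (ae_weight_ge0 X_ge0) (integrable_ae measurableT iS) => w w0.
move=> /(_ Logic.I) Sfin.
rewrite /hardy_space /=.
apply: (near_le_nneseries_lty (v := t)) => //.
- by move=> n; rewrite mulr_ge0 ?sqr_ge0.
- apply: near_fcoef_weight_le => //.
  apply: nneseries_lty_near_le1 => [k|]; first exact: Z0.
  by move: Sfin; rewrite ge0_fin_numE.
- by apply: le_lt_trans nneseries_pronic_inv_le1 _; rewrite ltry.
Qed.

(** With [W n = weight X n `^ (1 / sqrt n)], truncation at a level [K] gives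
    [W n <= Num.max 1 (Num.min (W n) K) + W n ^+ 2 / K].  If the Hardy norm is
    almost surely finite the truncated variables tend to 1 almost surely, hence
    in mean by dominated convergence; since [W n ^+ 2] has mean at most [B], this
    yields [1 + c <= 1 + B / K]. *)
Lemma not_hardy_star_of_moment_bounds (alpha B c : R) :
    (alpha < 2^-1)%R -> (0 < c)%R ->
    (forall n, (0 < n)%N ->
      (1 + c)%:E <= \int[P]_w (weight X n w `^ (Num.sqrt n%:R)^-1)%:E) ->
    (forall n, \int[P]_w (weight X n w `^ (2 / Num.sqrt n%:R))%:E <= B%:E) ->
  ~ hardy_star X (fcoef alpha).
Proof.
move=> alpha2 c0 Hc HB Hardy.
have B0 : (0 <= B)%R.
  rewrite -lee_fin (le_trans _ (HB 0%N))// integral_ge0// => w _.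
  by rewrite lee_fin powR_ge0.
(* Large enough for [B / K <= c / 2]; the summand 1 keeps it positive. *)
pose K : R := (1 + 2 * B / c)%R.
have K0 : (0 < K)%R by rewrite ltr_pwDl// divr_ge0 ?mulr_ge0// ltW.
have BK : (B / K <= c / 2)%R.
  rewrite ler_pdivrMr// /K mulrDr mulr1.
  have -> : (c / 2 * (2 * B / c) = B)%R by field; rewrite gt_eqF.
  by rewrite lerDr divr_ge0// ltW.
pose W n w := (weight X n w `^ (Num.sqrt n%:R)^-1)%R.
pose G n w := Num.max 1%R (Num.min (W n w) K).
have mW n : measurable_fun setT (W n) by exact: measurable_weight_powR.
have mG n : measurable_fun setT (G n).
  by apply: measurable_maxr => //; exact: measurable_minr.
have G1 n w : (1 <= G n w)%R by rewrite le_max lexx.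
have GK n w : (G n w <= Num.max 1 K)%R.
  rewrite ge_max; apply/andP; split; first by rewrite le_max lexx.
  by rewrite le_max !ge_min lexx !orbT.
have cvgG : {ae P, forall w, G n w @[n --> \oo] --> (1 : R)%R}.
  apply: filterS2 (ae_weight_ge0 X_ge0) Hardy => w w0 fin.
  have term1 := nneseries_lty_near_le1 (fun n => mulr_ge0 (sqr_ge0 _) (sqr_ge0 _)) fin.
  have Wle := near_powR_sqrt_le w0 term1.
  have up := powR_nat_powR_sqrt_cvg1 alpha2.
  apply: (@squeeze_cvgr _ _ _ _ (fun=> 1%R) _ _ _ _ _ up); last exact: cvg_cst.
  near=> n; rewrite G1/= ge_max; apply/andP; split; last first.
    by rewrite ge_min (near Wle n).
  have n1 : (1 <= n%:R :> R)%R by rewrite ler1n; near: n; exists 1%N.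
  by rewrite -[leLHS](powRr0 n%:R) ler_powR// divr_ge0// powR_ge0.
have limG : \int[P]_w (G n w)%:E @[n --> \oo] --> (1 : \bar R).
  have iK : P.-integrable setT (EFin \o (cst (Num.max 1 K)%R : T -> R)).
    exact: finite_measure_integrable_cst.
  have [] := @dominated_convergence _ T R P setT measurableT
    (fun n w => (G n w)%:E) (cst 1) _ _ _ _ iK _.
  - by move=> n; exact/measurable_EFinP.
  - exact: measurable_cst.
  - apply: filterS cvgG => w Gw _; apply/fine_cvgP; split; last exact: Gw.
    exact: nearW.
  - by apply: nearW => w n _; rewrite /= lee_fin ger0_norm// (le_trans ler01).
  have -> : \int[P]_w (cst 1 w : \bar R) = 1.
    by rewrite integral_cst// mul1e; exact: probability_setT.
  by [].
have : (1 + c)%:E <= 1 + (B / K)%:E.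
  have lim1 : (\int[P]_w (G n w)%:E + (B / K)%:E) @[n --> \oo] --> 1 + (B / K)%:E.
    by apply: cvgeD => //; exact: cvg_cst.
  apply: (cvge_to_ge lim1).
  near=> n.
  have n0 : (0 < n)%N by near: n; exists 1%N.
  apply: le_trans (Hc n n0) _.
  have mW2 : measurable_fun setT (fun w => weight X n w `^ (2 / Num.sqrt n%:R))%R.
    exact: measurable_weight_powR.
  apply: (@le_trans _ _ (\int[P]_w ((G n w)%:E +
      (K^-1)%:E * (weight X n w `^ (2 / Num.sqrt n%:R))%:E))).
    apply: ge0_le_integral => //.
    - by move=> w _; rewrite lee_fin powR_ge0.
    - by apply/measurable_EFinP; exact: measurable_weight_powR.
    - apply: emeasurable_funD; first exact/measurable_EFinP.
      by apply: measurable_funeM; exact/measurable_EFinP.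
    move=> w _; rewrite -EFinM -EFinD lee_fin -/(W n w).
    have -> : (weight X n w `^ (2 / Num.sqrt n%:R) = W n w ^+ 2)%R.
      by rewrite mulrC powRrM powR_mulrn// powR_ge0.
    have W0 : (0 <= W n w)%R by exact: powR_ge0.
    case: (leP (W n w) K) => WK.
      rewrite ler_wpDr//; first by rewrite mulr_ge0 ?sqr_ge0// invr_ge0 ltW.
      by rewrite /G le_max (min_l WK) lexx orbT.
    rewrite ler_wpDl ?(le_trans _ (G1 n w))//.
    by rewrite mulrC ler_pdivlMr// expr2 ler_wpM2l// ltW.
  rewrite ge0_integralD//; last first.
  - by apply: measurable_funeM; exact/measurable_EFinP.
  - by move=> w _; rewrite mule_ge0// lee_fin ?invr_ge0 ?powR_ge0// ltW.
  - exact/measurable_EFinP.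
  - by move=> w _; rewrite lee_fin (le_trans ler01).
  rewrite leeD2l// ge0_integralZl//.
  - by rewrite [(B / K)%R]mulrC EFinM lee_wpmul2l// lee_fin invr_ge0 ltW.
  - exact/measurable_EFinP.
  - by move=> w _; rewrite lee_fin powR_ge0.
  - by rewrite lee_fin invr_ge0 ltW.
rewrite -EFinD lee_fin lerD2l => /le_trans/(_ BK); lra.
Unshelve. all: by end_near. Qed.

End membership.

(* [lne] is the extended logarithm, with [lne 0 = -oo]. *)
Theorem lemma5p5 (R : realType) (d : measure_display) (T : measurableType d)
    (P : probability T R) (X : nat -> {RV P >-> R})
    (X_ge0 : forall n, {ae P, forall w, 0 <= X n w})
    (X_bounded : forall n, exists M : R, {ae P, forall w, `|X n w| <= M})
    (X_iid : iid X)
    (EX_ln : (\int[P]_w lne (X 0%N w)%:E = 0)%E)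
    (EX_ln2_gt0 : (0 < \int[P]_w (lne (X 0%N w)%:E ^+ 2))%E)
    (EX_ln2_fin : (\int[P]_w (lne (X 0%N w)%:E ^+ 2) < +oo)%E)
    (alpha : R) (alpha_gt0 : 0 < alpha) :
  hardy_star X (fcoef alpha) <-> 2^-1 <= alpha.
Proof.
have [M absX] := X_bounded 0%N.
have XM : {ae P, forall w, X 0%N w <= M}.
  by apply: filterS absX => w; apply: le_trans; exact: ler_norm.
have moment_ub := integral_weight_powR_sqrt_le X_ge0 X_iid XM EX_ln EX_ln2_fin.
split => [Hardy|alpha2]; last first.
  have [B _ HB] := moment_ub 6 (ler0n _ _).
  exact: hardy_star_of_moment_bound HB.
rewrite leNgt; apply/negP => alpha2.
have [B _ HB] := moment_ub 2 (ler0n _ _).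
have [c c0 Hc] :=
  integral_weight_powR_sqrt_ge X_ge0 X_iid XM EX_ln EX_ln2_fin EX_ln2_gt0.
exact: not_hardy_star_of_moment_bounds Hc HB Hardy.
Qed.
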